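(* Let $p$ be a prime and $q$ a power of $p$. Let $N\geq 5$, $q>3$, and let $\Gamma$ be a subgroup of $\mathrm{GL}_N(\mathbb{F}_q)$ such that (1) $\Gamma$ is absolutely irreducible; (2) $\Gamma$ contains $\mathrm{SL}_a(\mathbb{F}_q)$ for some $a\geq N/2$. If $N\neq 2a$, then $\Gamma$ contains $\mathrm{SL}_N(\mathbb{F}_q)$. Otherwise (if $N=2a$), either $\Gamma$ contains $\mathrm{SL}_N(\mathbb{F}_q)$, or $\Gamma$ is, up to conjugacy in $\mathrm{GL}_N(\mathbb{F}_q)$, a subgroup of $\mathrm{GL}_{N/2}(\mathbb{F}_q)\wr\mathfrak{S}_2$.
   Context: For $a\le N$, $\mathrm{SL}_a(\mathbb{F}_q)$ is viewed inside $\mathrm{GL}_N(\mathbb{F}_q)$ via the standard block embedding: it acts naturally on the span of $a$ basis vectors and trivially on the span of the remaining $N-a$ basis vectors. $\mathrm{GL}_{N/2}(\mathbb{F}_q)\wr\mathfrak{S}_2$ denotes the stabilizer in $\mathrm{GL}_N(\mathbb{F}_q)$ of an (unordered) decomposition $\mathbb{F}_q^N=W_1\oplus W_2$ with $\dim W_1=\dim W_2=N/2$. $\mathfrak{S}_2$ is the symmetric group on two letters. *)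

(* Defs.v *)
From HB Require Import structures.
From mathcomp Require Import all_boot all_order all_algebra all_fingroup
  all_solvable all_field all_character.
Set Implicit Arguments.
Unset Strict Implicit.
Unset Printing Implicit Defensive.
Import GroupScope GRing.Theory.
Local Open Scope ring_scope.

(* Matrices act on row vectors, on the right.  The library's {'GL_n[F]} consists
   of matrices of size n.-1.+1, i.e. of size n when n > 0. *)

Section LinearGroups.
Variables (F : finFieldType) (N : nat).

Definition SLn : {set {'GL_N[F]}} := [set g | \det (GLval g) == 1].

(* The block-diagonal matrix diag(A, 1) of size N: for a <= N and N > 0, the
   sizes a + (N - a) and N.-1.+1 are equal and conform_mx is a mere cast; its
   default value 1 is only used outside this range. *)
Definition std_block (a : nat) (A : 'M[F]_a) : 'M[F]_N.-1.+1 :=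
  conform_mx 1%:M (block_mx A 0 0 (1%:M : 'M[F]_(N - a))).

Definition SLblock (a : nat) : {set {'GL_N[F]}} :=
  [set g | [exists A : 'M[F]_a,
              (\det A == 1) && (GLval g == std_block A)]].

(* The stabilizer of the unordered pair of row spaces {W1, W2}. *)
Definition pair_stab (W1 W2 : 'M[F]_N.-1.+1) : {set {'GL_N[F]}} :=
  [set g | ((W1 *m GLval g == W1)%MS && (W2 *m GLval g == W2)%MS)
        || ((W1 *m GLval g == W2)%MS && (W2 *m GLval g == W1)%MS)].

(* GL_(N/2) wr S_2 for N even: the row space of pid_mx m is spanned by the first
   m basis vectors, that of copid_mx m by the remaining ones. *)
Definition GLwrS2 : {set {'GL_N[F]}} := pair_stab (pid_mx N./2) (copid_mx N./2).

Fact GLval_mx_repr (G : {group {'GL_N[F]}}) : mx_repr G (@GLval N F).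
Proof. by []. Qed.

Definition nat_repr (G : {group {'GL_N[F]}}) : mx_representation F G N.-1.+1 :=
  MxRepresentation (GLval_mx_repr G).

Definition absolutely_irreducible (G : {group {'GL_N[F]}}) : bool :=
  mx_absolutely_irreducible (nat_repr G).

(* The library defines absolute irreducibility by the enveloping algebra being
   the full matrix algebra; this is irreducibility over every extension of F. *)
Lemma absolutely_irreducibleP (G : {group {'GL_N[F]}}) :
  absolutely_irreducible G <->
  (forall (K : fieldType) (f : {rmorphism F -> K}),
     mx_irreducible (map_repr f (nat_repr G))).
Proof.
split=> [absG K f|irrG].
  by apply: mx_abs_irrW; rewrite map_mx_abs_irr.
have [//|nabs] := boolP (absolutely_irreducible G).
apply: (@group_closure_field_exists {'GL_N[F]} F) => -[K f closK].
have := closK G _ _ (irrG K f).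
by rewrite map_mx_abs_irr => absG; rewrite /absolutely_irreducible absG in nabs.
Qed.

End LinearGroups.

(* Main.v *)
Require Import Defs.
From HB Require Import structures.
From mathcomp Require Import all_boot all_order all_algebra all_fingroup
  all_solvable all_field all_character.
From mathcomp Require Import ring zify.

(** Vectors are rows w, linear forms are columns f, and a pair with w f = 0
    gives the transvections 1 + c f w (c a scalar), which send x to
    x + c (x f) w.  Everything is derived from the set of pairs (w, f) all of
    whose transvections lie in Gamma.  It is stable under sums in either
    argument, under conjugation by Gamma, and under a commutator rule
    ([has_root_comm]): if (v, f) and (w, g) are such pairs, w f = 0 and v g is
    not 0, then (w, f) is one too.

    An embedded SL_b is recorded by a [frame]: a family A of b rows and a dual
    family B of b columns, A B = 1, such that all the pairs (w, f) with w in the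
    span <A> of the rows, f in the span <B> of the columns and w f = 0 belong to
    the set.  Let A0 be the space of rows killed by B, so that the whole space
    is <A> + A0, and P = B A the projection onto <A>.  Call w in A0 attached to
    the frame when (w, f) is a pair for every f in <B>, and call a form f that
    kills A coattached when (w, f) is a pair for every w in <A>.  If w is
    attached, f coattached and w f nonzero, then w and f can be adjoined to the
    frame ([frame_extend]).  A frame of size N gives SL_N, since transvections
    generate SL_N ([transvections_generate_SL]).  Hence one may assume that the
    frame has size b < N and that w f = 0 for all attached w and coattached f.

    Commutators of a pair (w, f) with transvections of the frame show that the
    A0-component of w is attached as soon as f does not vanish on <A>
    ([attached_complement]); applied to the translates (A x, x^-1 B) of the
    frame by elements x of Gamma, this gives the alternative of
    [frame_rows_attached].  Transposing Gamma exchanges rows and columns and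
    yields the dual facts.  From N <= 2 b and irreducibility it then follows
    that the only attached vector is 0 ([attached_eq0]), and dually.  So each
    x either maps <A> into itself or has A x^-1 B = 0.  The first cannot hold
    for every x because Gamma is irreducible, and the second forces b <= N - b;
    hence N = 2 b, and looking at rows and columns together every x either
    commutes with P or exchanges P and 1 - P ([frame_imprimitive]).  Since b is
    at least a and a >= N / 2, this happens only for N = 2 a, and then Gamma
    preserves the decomposition into <A> and A0. *)

Set Implicit Arguments.
Unset Strict Implicit.
Unset Printing Implicit Defensive.

Import GRing.Theory.

(** * Transvections in a matrix group *)

Section Transvections.

Local Open Scope ring_scope.

Variables (F : finFieldType) (n : nat).
Implicit Types (S : {set 'M[F]_n}) (v w : 'rV[F]_n) (f g : 'cV[F]_n).

Definition transvection f w : 'M[F]_n := 1%:M + f *m w.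

(** The root subgroup of the pair (w, f) is contained in S; the pair is required
    to be orthogonal so that its elements are transvections. *)
Definition has_root S w f :=
  (w *m f == 0) && [forall c : F, transvection f (c *: w) \in S].

Definition mxgroup S :=
  [/\ 1%:M \in S, {in S &, forall x y, x *m y \in S}
    & {in S, forall x, x \in unitmx /\ invmx x \in S}].

(** Irreducibility of a group in a form that is visibly stable under
    transposition: the span of the orbit of a nonzero w is invariant, and it is
    proper exactly when some nonzero f vanishes on it. *)
Definition irreducible_mxset S :=
  forall w f, (forall x, x \in S -> w *m x *m f = 0) -> w = 0 \/ f = 0.

(** A conjugate of the block SL_b inside S.  Giving it by dual bases of the
    moved space and of the space of forms involved avoids any change of
    coordinates and makes the notion self-dual. *)
Definition frame S b (A : 'M[F]_(b, n)) (B : 'M[F]_(n, b)) :=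
  A *m B = 1%:M /\
  forall (u : 'rV_b) (z : 'cV_b), u *m z = 0 -> has_root S (u *m A) (B *m z).

Lemma mulmx_rank1 p f w g (M : 'M[F]_(1, p)) :
  (f *m w) *m (g *m M) = (w *m g) 0 0 *: (f *m M).
Proof.
by rewrite -mulmxA (mulmxA w) {1}[w *m g]mx11_scalar mul_scalar_mx -scalemxAr.
Qed.

Lemma has_rootP S w f :
  reflect (w *m f = 0 /\ forall c, transvection f (c *: w) \in S)
    (has_root S w f).
Proof.
by apply: (iffP andP) => -[/eqP wf0 /forallP Sfw]; split=> //; exact/eqP.
Qed.

Lemma has_root_orth S w f : has_root S w f -> w *m f = 0.
Proof. by case/has_rootP. Qed.

Lemma has_rootZl S c w f : has_root S w f -> has_root S (c *: w) f.
Proof.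
case/has_rootP=> wf0 Sfw; apply/has_rootP; split=> [|d]; last by rewrite scalerA Sfw.
by rewrite -scalemxAl wf0 scaler0.
Qed.

Lemma has_rootZr S c w f : has_root S w f -> has_root S w (c *: f).
Proof.
case/has_rootP=> wf0 Sfw; apply/has_rootP; split=> [|d].
  by rewrite -scalemxAr wf0 scaler0.
rewrite /transvection -scalemxAl scalemxAr scalerA; exact: Sfw.
Qed.

Lemma has_rootDl S w1 w2 f :
  mxgroup S -> has_root S w1 f -> has_root S w2 f -> has_root S (w1 + w2) f.
Proof.
case=> _ SM _ /has_rootP[w1f Sw1] /has_rootP[w2f Sw2]; apply/has_rootP; split=> [|c].
  by rewrite mulmxDl w1f w2f addr0.
have := SM _ _ (Sw1 c) (Sw2 c); congr (_ \in S).
rewrite /transvection mulmxDl !mulmxDr !mulmx1 !mul1mx mulmx_rank1.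
rewrite -scalemxAl w1f scaler0 mxE scale0r addr0 scalerDr mulmxDr.
by rewrite -addrA [f *m (c *: w2) + _]addrC.
Qed.

(** With X = f v and Y = g w one has X X = Y Y = Y X = 0, so that the group
    commutator of 1 + X and 1 + Y is 1 + X Y = 1 + (v g) f w. *)
Lemma has_root_comm S v f w g :
    mxgroup S -> has_root S v f -> has_root S w g -> w *m f = 0 -> v *m g != 0 ->
  has_root S w f.
Proof.
case=> _ SM _ /has_rootP[vf Sv] /has_rootP[wg Sw] wf vg; apply/has_rootP; split=> // c.
have [s s0 def_s] : exists2 s, s != 0 & v *m g = s%:M.
  exists ((v *m g) 0 0); last exact: mx11_scalar.
  by apply: contraNneq vg => vg0; rewrite [v *m g]mx11_scalar vg0 -scalemx1 scale0r.
(* This scaling makes the commutator below equal to 1 + c f w. *)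
pose d := c / s.
have := SM _ _ (SM _ _ (Sv d) (Sw 1)) (SM _ _ (Sv (- d)) (Sw (-1))).
congr (_ \in S); rewrite /transvection !scaleN1r !scale1r scaleNr !mulmxN.
have XY : f *m (d *: v) *m (g *m w) = f *m (c *: w).
  by rewrite mulmx_rank1 -scalemxAl def_s !mxE eqxx /d divfK // scalemxAr.
have YX : g *m w *m (f *m (d *: v)) = 0.
  by rewrite mulmx_rank1 wf mxE scale0r.
have XX : f *m (d *: v) *m (f *m (d *: v)) = 0.
  by rewrite mulmx_rank1 -scalemxAl vf scaler0 mxE scale0r.
have YY : g *m w *m (g *m w) = 0 by rewrite mulmx_rank1 wg mxE scale0r.
move: (f *m (d *: v)) (g *m w) (f *m (c *: w)) XY YX XX YY => X Y Z XY YX XX YY.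
have E1 : (1%:M + X) *m (1%:M + Y) = 1%:M + X + Y + Z.
  rewrite mulmxDl !mulmxDr !mulmx1 !mul1mx XY.
  by apply/matrixP=> i j; rewrite !mxE; ring.
have E2 : (1%:M - X) *m (1%:M - Y) = 1%:M - X - Y + Z.
  rewrite mulmxBl !mulmxBr !mulmx1 !mul1mx XY.
  by apply/matrixP=> i j; rewrite !mxE; ring.
have ZX : Z *m X = 0 by rewrite -XY -mulmxA YX mulmx0.
have ZY : Z *m Y = 0 by rewrite -XY -mulmxA YY mulmx0.
have XZ : X *m Z = 0 by rewrite -XY mulmxA XX mul0mx.
have YZ : Y *m Z = 0 by rewrite -XY mulmxA YX mul0mx.
have ZZ : Z *m Z = 0 by rewrite -{1}XY -mulmxA YZ mulmx0.
rewrite E1 E2 !(mulmxDl, mulmxBr, mulmxDr, mulmx1, mul1mx).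
rewrite !(XY, YX, XX, YY, ZX, ZY, XZ, YZ, ZZ) !(subr0, addr0, sub0r, add0r).
apply/matrixP=> i j; rewrite !mxE.
ring.
Qed.

Lemma has_rootJ S x w f :
  mxgroup S -> x \in S -> has_root S w f -> has_root S (w *m x) (invmx x *m f).
Proof.
move=> [_ SM SV] Sx /has_rootP[wf Sw]; have [ux Sx'] := SV _ Sx.
apply/has_rootP; split=> [|c]; first by rewrite mulmxA mulmxK.
have := SM _ _ (SM _ _ Sx' (Sw c)) Sx; congr (_ \in S).
by rewrite /transvection mulmxDr mulmxDl mulmx1 mulVmx // scalemxAl !mulmxA.
Qed.

Lemma frameJ S b (A : 'M_(b, n)) (B : 'M_(n, b)) x :
  mxgroup S -> x \in S -> frame S A B -> frame S (A *m x) (invmx x *m B).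
Proof.
move=> grS Sx [AB rAB]; have [_ _ /(_ _ Sx)[ux _]] := grS.
split=> [|u z uz]; first by rewrite mulmxA mulmxK.
by rewrite (mulmxA u) -(mulmxA _ B); apply: has_rootJ => //; apply: rAB.
Qed.

End Transvections.

(** * Transposition *)

Section Transpose.
Local Open Scope ring_scope.

Variables (F : finFieldType) (n : nat).
Implicit Types (S : {set 'M[F]_n}) (v w : 'rV[F]_n) (f g : 'cV[F]_n).

Definition trset S : {set 'M[F]_n} := [set x | x^T \in S].

Lemma has_root_tr S w f : has_root (trset S) f^T w^T = has_root S w f.
Proof.
rewrite /has_root -trmx_mul -trmx0 (inj_eq trmx_inj) trmx0; congr (_ && _).
apply: eq_forallb => c; rewrite inE /transvection linearD /= trmx1 trmx_mul.
by rewrite linearZ /= !trmxK -scalemxAl scalemxAr.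
Qed.

Lemma mxgroup_tr S : mxgroup S -> mxgroup (trset S).
Proof.
case=> S1 SM SV; split=> [|x y|x]; rewrite !inE ?trmx1 // ?trmx_mul.
  by move=> Sx Sy; exact: SM.
by case/SV; rewrite unitmx_tr trmx_inv.
Qed.

Lemma irreducible_mxset_tr S :
  irreducible_mxset S -> irreducible_mxset (trset S).
Proof.
move=> irrS w f Swf; case: (irrS f^T w^T) => [x Sx||].
- apply: trmx_inj; rewrite !trmx_mul !trmxK mulmxA trmx0 Swf //.
  by rewrite inE trmxK.
- by move/(congr1 trmx); rewrite trmxK trmx0; right.
by move/(congr1 trmx); rewrite trmxK trmx0; left.
Qed.

Lemma frame_tr S b (A : 'M_(b, n)) (B : 'M_(n, b)) :
  frame S A B -> frame (trset S) B^T A^T.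
Proof.
case=> AB rAB; split=> [|u z uz]; first by rewrite -trmx_mul AB trmx1.
rewrite -[u]trmxK -[z]trmxK -!trmx_mul has_root_tr; apply: rAB.
by apply: trmx_inj; rewrite trmx_mul !trmxK trmx0.
Qed.

End Transpose.

(** * Vectors attached to a frame *)

Section Frames.

Local Open Scope ring_scope.

Lemma separating_row (F : fieldType) b (z y : 'cV[F]_b) :
  ~ (exists c, y = c *: z) -> exists2 u : 'rV_b, u *m z = 0 & u *m y != 0.
Proof.
move=> nyz; have : ~~ (y^T <= z^T)%MS.
  apply/negP=> /sub_rVP[c /(congr1 trmx)]; rewrite linearZ /= !trmxK => def_y.
  by apply: nyz; exists c.
rewrite submxE -trmx0 -[_ *m _]trmxK (inj_eq trmx_inj) trmx_mul trmxK.
set K := _^T => Ky; have /existsP[i Kyi] : [exists i, row i (K *m y) != 0].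
  apply: contraR Ky; rewrite negb_exists => /forallP Ky.
  by apply/eqP/row_matrixP=> i; rewrite row0; apply/eqP/negPn/Ky.
exists (row i K); last by rewrite -row_mul.
rewrite -row_mul; apply/rowP=> j; rewrite !mxE.
have /(congr1 trmx)/matrixP/(_ i j) := mulmx_coker z^T.
by rewrite trmx_mul trmxK trmx0 !mxE.
Qed.

Lemma mulmx_cV_neq0 (F : fieldType) m b (M : 'M[F]_(m, b)) :
  M != 0 -> exists z : 'cV_b, M *m z != 0.
Proof.
case/matrix0Pn=> i [j Mij]; exists (delta_mx j 0); rewrite -colE.
by apply/matrix0Pn; exists i, 0; rewrite mxE.
Qed.

Lemma mulmx_rV_neq0 (F : fieldType) m b (M : 'M[F]_(m, b)) :
  M != 0 -> exists u : 'rV_m, u *m M != 0.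
Proof.
case/matrix0Pn=> i [j Mij]; exists (delta_mx 0 i); rewrite -rowE.
by apply/matrix0Pn; exists 0, j; rewrite mxE.
Qed.

(** The orthogonal of u is at least a plane, so no line contains it. *)
Lemma orth_col_indep (F : fieldType) b (u : 'rV[F]_b) (y : 'cV_b) :
  (2 < b)%N -> exists2 z : 'cV_b, u *m z = 0 & ~ (exists c, z = c *: y).
Proof.
move=> b_gt2; have : ~~ (kermx u^T <= y^T)%MS.
  apply/negP=> /mxrankS; rewrite mxrank_ker => le_r.
  have := leq_trans le_r (rank_leq_row _); rewrite leq_subLR.
  have := rank_leq_col u^T; case: (\rank _) => [|[|k]] // _.
    by rewrite leqNgt (leq_trans _ b_gt2).
  by rewrite leqNgt b_gt2.
case/row_subPn=> i nKy; exists (row i (kermx u^T))^T.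
  apply: trmx_inj; rewrite trmx_mul trmxK trmx0 -row_mul.
  by rewrite mulmx_ker row0.
case=> c /(congr1 trmx); rewrite trmxK linearZ /= => def_r.
by case/negP: nKy; apply/sub_rVP; exists c.
Qed.

Variables (F : finFieldType) (n : nat) (S : {set 'M[F]_n}).
Variables (b : nat) (A : 'M[F]_(b, n)) (B : 'M[F]_(n, b)).
Hypotheses (grS : mxgroup S) (frAB : frame S A B).
Implicit Types (v w : 'rV[F]_n) (f g : 'cV[F]_n).

(** Taking all z forces w B = 0: attached vectors lie in the complement of the
    span of A. *)
Definition attached w := [forall z : 'cV[F]_b, has_root S w (B *m z)].

Lemma attachedP w :
  reflect (forall z, has_root S w (B *m z)) (attached w).
Proof. exact: forallP. Qed.

Lemma attached_orth w : attached w -> w *m B = 0.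
Proof.
move/attachedP=> rw; apply/eqP; apply: contraT => /mulmx_cV_neq0[z].
by rewrite -mulmxA (has_root_orth (rw z)) eqxx.
Qed.

Lemma attachedD w1 w2 : attached w1 -> attached w2 -> attached (w1 + w2).
Proof.
by move=> /attachedP X1 /attachedP X2; apply/attachedP=> z; apply: has_rootDl.
Qed.

(** Commutators with the transvections of the frame carry one form of the span
    of B to any form that is not proportional to it. *)
Lemma attached_spread w (z : 'cV_b) :
  z != 0 -> w *m B = 0 -> has_root S w (B *m z) -> attached w.
Proof.
move=> z0 wB rz; apply/attachedP=> y.
have [/existsP[c /eqP def_z] | nzy] := boolP [exists c, z == c *: y].
  have c0 : c != 0.
    by apply: contraNneq z0 => c0; rewrite def_z c0 scale0r.
  by have := has_rootZr c^-1 rz; rewrite def_z -!scalemxAr scalerA mulVf // scale1r.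
have [|u uy uz] := @separating_row _ _ y z.
  by case=> c def_z; case/existsP: nzy; exists c; apply/eqP.
have [AB rAB] := frAB; apply: (has_root_comm grS (rAB u y uy) rz).
  by rewrite mulmxA wB mul0mx.
by rewrite mulmxA -(mulmxA u) AB mulmx1.
Qed.

(** Choose z orthogonal to w and independent of A f; such a z exists because
    b > 2.  A commutator of (w, f) with a transvection of the frame whose
    vector is not killed by f gives the pair (w, B z), and the frame itself
    contains (w P, B z), P = B A.  The difference is (w - w P, B z), and
    [attached_spread] applies. *)
Lemma attached_complement w f :
  (2 < b)%N -> has_root S w f -> A *m f != 0 -> attached (w - w *m (B *m A)).
Proof.
move=> b_gt2 rwf Af0; have [AB rAB] := frAB.
have [z wBz nzf] := orth_col_indep (w *m B) (A *m f) b_gt2.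
have z0 : z != 0.
  by apply: contra_not_neq nzf => ->; exists 0; rewrite scale0r.
have [|u uz uf] := @separating_row _ _ z (A *m f).
  case=> c def_Af; case: nzf; exists c^-1.
  have c0 : c != 0 by apply: contraNneq Af0 => c0; rewrite def_Af c0 scale0r.
  by rewrite def_Af scalerA mulVf // scale1r.
have rwz : has_root S w (B *m z).
  apply: (has_root_comm grS (rAB u z uz) rwf); first by rewrite mulmxA.
  by rewrite -mulmxA.
apply: (attached_spread z0).
  by rewrite mulmxBl -!mulmxA AB mulmx1 subrr.
have /(has_rootZl (-1)) := rAB _ _ wBz; rewrite scaleN1r mulmxA -mulmxA.
exact: has_rootDl.
Qed.

(** Write K = A B', the matrix of the forms of B' restricted to the span of A.
    By [attached_complement] the conclusion holds for u as soon as some z with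
    u z = 0 has K z nonzero.  Since K is nonzero, the exceptional u lie on one
    line, so every u is a sum of two vectors which are not exceptional. *)
Lemma frame_rows_attached (A' : 'M[F]_(b, n)) (B' : 'M[F]_(n, b)) :
    (2 < b)%N -> frame S A' B' -> A *m B' != 0 ->
  forall u, attached (u *m A' - u *m A' *m (B *m A)).
Proof.
move=> b_gt2 [A'B' rA'] K0.
have good u (z : 'cV_b) : u *m z = 0 -> A *m B' *m z != 0 ->
    attached (u *m A' - u *m A' *m (B *m A)).
  move=> uz Kz; have rz := rA' _ _ uz.
  by apply: (attached_complement b_gt2 rz); rewrite mulmxA.
have [z0 Kz0] := mulmx_cV_neq0 K0.
move=> u; have [uz0 | uz0] := eqVneq (u *m z0) 0; first exact: good Kz0.
have [|bad] := boolP [exists z : 'cV_b, (u *m z == 0) && (A *m B' *m z != 0)].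
  by case/existsP=> z /andP[/eqP]; exact: good.
have {}bad (z : 'cV_b) : u *m z = 0 -> A *m B' *m z = 0.
  move=> uz; apply/eqP; apply: contraNT bad => Kz.
  by apply/existsP; exists z; rewrite uz eqxx.
pose s := (u *m z0) 0 0; have def_s : u *m z0 = s%:M by apply: mx11_scalar.
have s0 : s != 0.
  by apply: contraNneq uz0 => s0; rewrite def_s s0 -scalemx1 scale0r.
have [u' u'z0 [z1 u'z1]] : exists2 u' : 'rV_b,
    u' *m z0 = 0 & exists z1 : 'cV_b, u' *m z1 = 1%:M.
  have [z' z0z' nz'] := orth_col_indep z0^T 0 b_gt2.
  exists z'^T; first by apply: trmx_inj; rewrite trmx_mul trmxK z0z' trmx0.
  have [|z1 u'z1] := @mulmx_cV_neq0 _ _ _ z'^T.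
    apply: contra_not_neq nz' => /(congr1 trmx); rewrite trmxK trmx0 => ->.
    by exists 0; rewrite scaler0.
  have := u'z1; rewrite [_ *m z1]mx11_scalar; set c := _ 0 0 => c0.
  exists (c^-1 *: z1).
  rewrite -scalemxAr [_ *m z1]mx11_scalar -/c scale_scalar_mx mulVf //.
  by apply: contraNneq c0 => ->; rewrite -scalemx1 scale0r.
(* If u is exceptional then K kills z2, which u kills and u' does not; adding
   the right multiple of z2 to z0 makes z0 orthogonal to u - u' without
   changing its image under K, so neither u' nor u - u' is exceptional. *)
pose r := (u *m z1) 0 0; have def_r : u *m z1 = r%:M by apply: mx11_scalar.
pose z2 := z1 - (r / s) *: z0.
have uz2 : u *m z2 = 0.
  by rewrite mulmxBr -scalemxAr def_r def_s scale_scalar_mx divfK // subrr.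
have u'z2 : u' *m z2 = 1%:M by rewrite mulmxBr -scalemxAr u'z0 scaler0 subr0.
have good1 : attached ((u - u') *m A' - (u - u') *m A' *m (B *m A)).
  apply: (good _ (z0 + s *: z2)).
    rewrite mulmxBl !mulmxDr -!scalemxAr def_s uz2 u'z0 u'z2 scaler0 addr0 add0r.
    by rewrite scale_scalar_mx mulr1 subrr.
  by rewrite mulmxDr -scalemxAr (bad _ uz2) scaler0 addr0.
have := attachedD good1 (good _ _ u'z0 Kz0).
by rewrite addrACA -opprD -!mulmxDl subrK.
Qed.

End Frames.

(** * Functionals attached to a frame; enlarging a frame *)

Section Dual.

Local Open Scope ring_scope.

Lemma mulmx_cV_eq0 (F : fieldType) m b (M : 'M[F]_(m, b)) :
  (forall z : 'cV_b, M *m z = 0) -> M = 0.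
Proof.
move=> M0; apply/eqP; apply: contraT => /mulmx_cV_neq0[z].
by rewrite M0 eqxx.
Qed.

Lemma mulmx_rV_eq0 (F : fieldType) m b (M : 'M[F]_(m, b)) :
  (forall u : 'rV_m, u *m M = 0) -> M = 0.
Proof.
move=> M0; apply/eqP; apply: contraT => /mulmx_rV_neq0[u].
by rewrite M0 eqxx.
Qed.

(** The rows of A lie in the left kernel of B, whose dimension n - b is at most
    b, the rank of A; so they span it. *)
Lemma perp_row_span (F : fieldType) m n b
    (A B1 : 'M[F]_(b, n)) (A1 B : 'M[F]_(n, b)) (M : 'M_(m, n)) :
    A *m A1 = 1%:M -> B1 *m B = 1%:M -> A *m B = 0 -> (n <= 2 * b)%N ->
  M *m B = 0 -> exists C, M = C *m A.
Proof.
move=> AA1 B1B AB le_n MB; apply/submxP.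
have rA : \rank A = b by apply/eqP; apply/row_freeP; exists A1.
have rB : \rank B = b by apply/eqP; apply/row_fullP; exists B1.
have sAK : (A <= kermx B)%MS by apply/sub_kermxP.
have : (A == kermx B)%MS.
  rewrite -(geq_leqif (mxrank_leqif_eq sAK)) mxrank_ker rA rB leq_subLR.
  by rewrite addnn -mul2n.
by case/andP=> _; apply: submx_trans; apply/sub_kermxP.
Qed.

Variables (F : finFieldType) (n : nat) (S : {set 'M[F]_n}).
Variables (b : nat) (A : 'M[F]_(b, n)) (B : 'M[F]_(n, b)).
Hypotheses (grS : mxgroup S) (frAB : frame S A B) (b_gt2 : (2 < b)%N).
Implicit Types (v w : 'rV[F]_n) (f g : 'cV[F]_n).

(** The notion dual to [attached], obtained by transposing the group, so that
    each fact about [attached] has its dual for free. *)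
Definition coattached f := attached (trset S) A^T f^T.

Lemma has_rootDr w f1 f2 :
  has_root S w f1 -> has_root S w f2 -> has_root S w (f1 + f2).
Proof.
rewrite -!(has_root_tr _ w) linearD; exact: has_rootDl (mxgroup_tr grS).
Qed.

Lemma coattachedP f :
  reflect (forall u, has_root S (u *m A) f) (coattached f).
Proof.
apply: (iffP (attachedP _ _ _)) => rf u; last first.
  by rewrite -[u]trmxK -trmx_mul has_root_tr.
by rewrite -has_root_tr trmx_mul; apply: rf.
Qed.

Lemma coattached_orth f : coattached f -> A *m f = 0.
Proof. by move/attached_orth/(congr1 trmx); rewrite trmx_mul !trmxK trmx0. Qed.

Lemma coattached_complement w f :
  has_root S w f -> w *m B != 0 -> coattached (f - B *m A *m f).
Proof.
rewrite -has_root_tr => rwf wB; rewrite /coattached linearB /= !trmx_mul.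
apply: (attached_complement (mxgroup_tr grS) (frame_tr frAB) b_gt2 rwf).
by rewrite -trmx_mul -trmx0 (inj_eq trmx_inj).
Qed.

Lemma frame_cols_coattached (A' : 'M[F]_(b, n)) (B' : 'M[F]_(n, b)) :
    frame S A' B' -> A' *m B != 0 ->
  forall z, coattached (B' *m z - B *m A *m (B' *m z)).
Proof.
move=> fr' K0 z; rewrite /coattached linearB /= !trmx_mul.
apply: (frame_rows_attached (mxgroup_tr grS) (frame_tr frAB) b_gt2 (frame_tr fr')).
by rewrite -trmx_mul -trmx0 (inj_eq trmx_inj).
Qed.

(** An orthogonal pair of the enlarged spans is reached by one commutator, of a
    pair whose form is in the span of B with a pair whose vector is in the span
    of A; both kinds are sums of pairs of the frame and of pairs provided by
    the hypotheses on w and f. *)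
Lemma frame_extend w f :
    attached S B w -> coattached f -> w *m f != 0 ->
  exists A1 : 'M_(b + 1, n), exists B1 : 'M_(n, b + 1), frame S A1 B1.
Proof.
move=> Xw Yf wf; have [AB rAB] := frAB.
pose s := (w *m f) 0 0; have def_s : w *m f = s%:M by apply: mx11_scalar.
have s0 : s != 0.
  by apply: contraNneq wf => s0; rewrite def_s s0 -scalemx1 scale0r.
pose w' := s^-1 *: w.
exists (col_mx A w'), (row_mx B f); split=> [|u z].
  rewrite mul_col_row AB (coattached_orth Yf) -!scalemxAl (attached_orth Xw).
  by rewrite scaler0 def_s scale_scalar_mx mulVf // -scalar_mx_block.
rewrite -[u]hsubmxK -[z]vsubmxK mul_row_col !mul_row_col.
move: (lsubmx u) (rsubmx u) (usubmx z) (dsubmx z) => u1 u2 z1 z2 uz.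
rewrite [u2]mx11_scalar [z2]mx11_scalar mul_scalar_mx mul_mx_scalar.
set t := z2 0 0; have rX y : has_root S (u2 0 0 *: w') (B *m y).
  by do 2!apply: has_rootZl; exact: (attachedP _ _ _ Xw).
have rY (v : 'rV_b) : has_root S (v *m A) (t *: f).
  by apply: has_rootZr; exact: (coattachedP _ Yf).
have [y u1y nzy] := orth_col_indep u1 z1 b_gt2.
have [v vz1 vy] := separating_row nzy.
apply: (@has_root_comm _ _ _ (v *m A) _ _ (B *m y)) => //.
- by apply: has_rootDr; rewrite ?rAB ?rY.
- by apply: has_rootDl; rewrite ?rAB ?rX.
- rewrite mulmxDl !mulmxDr -!scalemxAl -!scalemxAr !mulmxA.
  rewrite -(mulmxA u1 A) AB mulmx1 -(mulmxA u1 A) (coattached_orth Yf).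
  rewrite (attached_orth Xw) def_s mulmx0 mul0mx !scaler0 add0r addr0.
  rewrite !scale_scalar_mx (mulrCA s^-1) mulVf // mulr1 -uz; congr (_ + _).
  by rewrite [in RHS](mx11_scalar u2) [in RHS](mx11_scalar z2) -scalar_mxM.
by rewrite mulmxA -(mulmxA v) AB mulmx1.
Qed.

Section Rigid.

Hypotheses (irrS : irreducible_mxset S) (b_lt_n : (b < n)%N).
Hypothesis (n_le2b : (n <= 2 * b)%N).
Hypothesis no_pair :
  forall w f, attached S B w -> coattached f -> w *m f = 0.

Lemma frame_neq0 (A' : 'M[F]_(b, n)) (B' : 'M[F]_(n, b)) :
  A' *m B' = 1%:M -> A' != 0 /\ B' != 0.
Proof.
move=> A'B'; have b_gt0 : (0 < b)%N by apply: leq_trans b_gt2.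
have id0 : (1%:M : 'M[F]_b) != 0 by rewrite -mxrank_eq0 mxrank1 -lt0n.
by split; apply: contraNneq id0 => M0; rewrite -A'B' M0 ?mul0mx ?mulmx0.
Qed.

(** Suppose w attached and nonzero.  If A x^-1 B = 0 for some x, then w x is in
    the span of A, whence every x^-1 B z is coattached, w x^-1 B = 0 and w is
    itself in the span of A: impossible.  So [frame_rows_attached] applies to
    all translates of the frame: the orbit of the span of A stays in its sum
    with the attached vectors.  Coattached forms vanish on that sum, hence are 0
    by irreducibility.  By the dual statements, the span of B is then invariant,
    which contradicts irreducibility as b < n. *)
Lemma attached_eq0 w : attached S B w -> w = 0.
Proof.
move=> Xw; apply/eqP; apply: contraT => w0; have [AB rAB] := frAB.
have [nzA nzB] := frame_neq0 AB; have [_ _ SV] := grS.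
have wB := attached_orth Xw; have /attachedP rX := Xw.
have rXg x z : x \in S -> has_root S (w *m x) (invmx x *m B *m z).
  by move=> Sx; rewrite -mulmxA; apply: has_rootJ.
have AxB x : x \in S -> A *m (invmx x *m B) != 0.
  move=> Sx; apply: (contraNneq _ w0) => AVxB.
  have [ux _] := SV x Sx; have [AxVxB _] := frameJ grS Sx frAB.
  have [C def_wx]: exists C, w *m x = C *m A.
    apply: (perp_row_span AB AxVxB AVxB n_le2b).
    by rewrite mulmxA mulmxK.
  have wxB : w *m x *m B != 0.
    apply: (contraNneq _ w0); rewrite def_wx -mulmxA AB mulmx1 => C0.
    by rewrite -[w](mulmxK ux) def_wx C0 !mul0mx.
  have wVxB : w *m (invmx x *m B) = 0.
    apply: mulmx_cV_eq0 => z; rewrite -mulmxA; apply: no_pair => //.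
    have := coattached_complement (rXg x z Sx) wxB.
    by rewrite (mulmxA (B *m A)) -(mulmxA B) AVxB mulmx0 mul0mx subr0.
  have [D def_w] := perp_row_span AB AxVxB AVxB n_le2b wVxB.
  by apply/eqP; rewrite def_w -[D]mulmx1 -AB mulmxA -def_w wB mul0mx.
have Y0 f : coattached f -> f = 0.
  move=> Yf; have [u uA] := mulmx_rV_neq0 nzA.
  case: (irrS (w := u *m A) (f := f)) => // [x Sx|uA0]; last first.
    by rewrite uA0 eqxx in uA.
  have := frame_rows_attached grS frAB b_gt2 (frameJ grS Sx frAB) (AxB x Sx) u.
  move/no_pair/(_ Yf); rewrite mulmxBl -!mulmxA (coattached_orth Yf) !mulmx0.
  by rewrite subr0 !mulmxA.
have VxB x : x \in S -> invmx x *m B = B *m A *m (invmx x *m B).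
  move=> Sx; have [ux _] := SV x Sx; have frx := frameJ grS Sx frAB.
  pose Bx := invmx x *m B.
  have def_B : (forall z, coattached (Bx *m z - B *m A *m (Bx *m z))) ->
      invmx x *m B = B *m A *m (invmx x *m B).
    move=> Yz; apply/eqP; rewrite -subr_eq0; apply/eqP.
    by apply: mulmx_cV_eq0 => z; rewrite mulmxBl -(mulmxA (B *m A)); apply: Y0.
  have [AxB0 | AxB0] := eqVneq (A *m x *m B) 0; last first.
    exact: def_B (frame_cols_coattached frx AxB0).
  have [wxB | wxB] := eqVneq (w *m x *m B) 0; last first.
    by apply: def_B => z; apply: coattached_complement wxB; apply: rXg.
  have [C def_wx] := perp_row_span (proj1 frx) AB AxB0 n_le2b wxB.
  have def_w : w = C *m A by apply: (can_inj (mulmxK ux)); rewrite def_wx mulmxA.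
  by case/negP: w0; rewrite def_w -[C]mulmx1 -AB mulmxA -def_w wB mul0mx.
have nzK : kermx B != 0.
  rewrite -mxrank_eq0 mxrank_ker -lt0n subn_gt0.
  exact: leq_ltn_trans (rank_leq_col B) b_lt_n.
have [v v0 vB] : exists2 v : 'rV_n, v != 0 & v *m B = 0.
  have [u uK] := mulmx_rV_neq0 nzK; exists (u *m kermx B) => //.
  by rewrite -mulmxA mulmx_ker mulmx0.
have [z Bz] := mulmx_cV_neq0 nzB.
case: (irrS (w := v) (f := B *m z)) => [x Sx|v_eq0|Bz0].
- have [_ /VxB] := SV x Sx; rewrite invmxK => def_xB.
  by rewrite mulmxA -(mulmxA _ x) def_xB !mulmxA vB !mul0mx.
- by rewrite v_eq0 eqxx in v0.
by rewrite Bz0 eqxx in Bz.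
Qed.

End Rigid.

End Dual.

(** * Transvections generate the special linear group *)

Section Generation.

Local Open Scope ring_scope.

Variable F : finFieldType.

(** The two block factorizations compare det (1 + f w) with the determinant of
    the matrix 1 + w f of size 1. *)
Lemma det_transvection n (f : 'cV[F]_n) (w : 'rV_n) :
  w *m f = 0 -> \det (transvection f w) = 1.
Proof.
move=> wf.
have : block_mx (1%:M : 'M_1) 0 f 1%:M
         *m block_mx 1%:M (- w) 0 (transvection f w)
    = block_mx (1%:M + w *m f) (- w) 0 1%:M *m block_mx 1%:M 0 f 1%:M.
  rewrite !mulmx_block /transvection !(mulmx1, mul1mx, mulmx0, mul0mx) !(addr0, add0r).
  by rewrite !mulmxN mulNmx addrK (addrC 1%:M) addKr.
move/(congr1 determinant); rewrite !det_mulmx !det_ublock !det_lblock.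
by rewrite wf addr0 !det1 !mul1r.
Qed.

Lemma transvectionK n (f : 'cV[F]_n) (w : 'rV_n) :
  w *m f = 0 -> transvection f w *m transvection f (- w) = 1%:M.
Proof.
move=> wf; rewrite /transvection mulmxDl !mulmxDr !mulmx1 !mul1mx mulmx_rank1.
by rewrite wf mxE scale0r addr0 mulmxN addrAC addrK.
Qed.

(** The inverse T' of T is recorded because S is only assumed to be closed under
    products. *)
Definition movable n (S : {set 'M[F]_n}) (w v : 'rV_n) :=
  exists T, exists2 T', T \in S
    & [/\ T' \in S, T *m T' = 1%:M, \det T = 1 & w *m T = v].

Lemma movable_trans n (S : {set 'M[F]_n}) w v u :
  {in S &, forall x y, x *m y \in S} ->
  movable S w v -> movable S v u -> movable S w u.
Proof.
move=> SM [T [T' ST [ST' TT' dT wT]]] [U [U' SU [SU' UU' dU vU]]].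
exists (T *m U), (U' *m T'); rewrite ?SM //; split; rewrite ?SM //.
- by rewrite mulmxA -(mulmxA T) UU' mulmx1.
- by rewrite det_mulmx dT dU mulr1.
by rewrite mulmxA wT.
Qed.

(** A form g with w g = v g = 1 exists by independence, and the transvection
    1 + g (v - w) sends w to v. *)
Lemma movable_indep n (S : {set 'M[F]_n}) w v :
    (forall f u, u *m f = 0 -> transvection f u \in S) ->
    w != 0 -> ~ (exists c, v = c *: w) -> movable S w v.
Proof.
move=> ST w0 nvw; have [|f wvf wf] := @separating_row F n (v - w)^T w^T.
  case=> c /(congr1 trmx); rewrite linearZ /= !trmxK => def_w; apply: nvw.
  have c0 : c != 0 by apply: contraNneq w0 => c0; rewrite def_w c0 scale0r.
  exists (1 + c^-1); rewrite scalerDl scale1r {2}def_w scalerA mulVf // scale1r.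
  by rewrite addrC subrK.
have {}wvf : (v - w) *m f^T = 0.
  by apply: trmx_inj; rewrite trmx_mul trmxK trmx0.
have {}wf : w *m f^T != 0.
  by rewrite -trmx0 -[_ *m _]trmxK (inj_eq trmx_inj) trmx_mul trmxK.
pose s := (w *m f^T) 0 0; have def_s : w *m f^T = s%:M by apply: mx11_scalar.
have s0 : s != 0.
  by apply: contraNneq wf => s0; rewrite def_s s0 -scalemx1 scale0r.
pose g := s^-1 *: f^T.
have wvg : (v - w) *m g = 0 by rewrite -scalemxAr wvf scaler0.
exists (transvection g (v - w)), (transvection g (- (v - w))).
  exact: ST.
split; rewrite ?transvectionK ?det_transvection //.
  by apply: ST; rewrite mulNmx wvg oppr0.
rewrite mulmxDr mulmx1 mulmxA -scalemxAr def_s scale_scalar_mx mulVf //.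
by rewrite mul1mx addrC subrK.
Qed.

(** For proportional vectors, pass through a third vector off their line. *)
Lemma movable_nonzero n (S : {set 'M[F]_n}) w v :
    (1 < n)%N -> {in S &, forall x y, x *m y \in S} ->
    (forall f u, u *m f = 0 -> transvection f u \in S) ->
  w != 0 -> v != 0 -> movable S w v.
Proof.
move=> n_gt1 SM ST w0 v0.
have [/existsP[c /eqP def_v] | nvw] := boolP [exists c, v == c *: w]; last first.
  apply: movable_indep => // -[c def_v].
  by case/existsP: nvw; exists c; apply/eqP.
have : ~~ (1%:M <= w)%MS.
  apply/negP=> /mxrankS; rewrite mxrank1 => /leq_trans/(_ (rank_leq_row w)).
  by rewrite leqNgt n_gt1.
case/row_subPn=> i; set u := row i _ => nuw.
have {}nuw : ~ exists c, u = c *: w.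
  by case=> d def_u; case/negP: nuw; apply/sub_rVP; exists d.
have u0 : u != 0.
  by apply: contra_not_neq nuw => ->; exists 0; rewrite scale0r.
apply: (movable_trans SM (movable_indep ST w0 nuw)).
apply: movable_indep => // -[d def_vd]; apply: nuw; exists (d^-1 * c).
have d0 : d != 0 by apply: contraNneq v0 => d0; rewrite def_vd d0 scale0r.
by rewrite -scalerA -def_v def_vd scalerA mulVf // scale1r.
Qed.

Definition transvection_closed n (S : {set 'M[F]_n}) :=
  [/\ 1%:M \in S, {in S &, forall x y, x *m y \in S}
    & forall f w, w *m f = 0 -> transvection f w \in S].

(** Move the first row of M to the first basis vector e.  The rest of the first
    column is then cleared by the single transvection along e, which leaves a
    block of size one less. *)
Lemma transvection_closed_SL_step n (S : {set 'M[F]_(1 + n.+1)}) :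
    (forall S' : {set 'M[F]_n.+1}, transvection_closed S' ->
       forall x, \det x = 1 -> x \in S') ->
  transvection_closed S -> forall M, \det M = 1 -> M \in S.
Proof.
move=> IHn [S1 SM ST] M detM.
pose S' := [set x | block_mx (1%:M : 'M_1) 0 0 x \in S].
have {}IHn : forall x, \det x = 1 -> x \in S'.
  apply: IHn; split=> [|x y|f w wf]; rewrite !inE.
  - by rewrite -scalar_mx_block.
  - move=> Sx Sy; have := SM _ _ Sx Sy.
    by rewrite mulmx_block !(mulmx0, mul0mx, mulmx1) !(addr0, add0r).
  have := ST (col_mx 0 f) (row_mx 0 w).
  rewrite /transvection mul_row_col mul0mx add0r mul_col_row !mul0mx mulmx0.
  rewrite (scalar_mx_block 1 n.+1) add_block_mx !(addr0, add0r).
  by apply.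
pose e : 'rV[F]_(1 + n.+1) := row_mx 1%:M 0.
have e0 : e != 0.
  apply/eqP=> /(congr1 lsubmx); rewrite row_mxKl linear0 => /eqP.
  by rewrite -mxrank_eq0 mxrank1.
have w0 : usubmx M != 0.
  have uM : M \in unitmx by rewrite unitmxE detM unitr1.
  apply/eqP=> M0; case/eqP: e0; apply: (can_inj (mulmxK uM)).
  by rewrite -{1}[M]vsubmxK M0 mul_row_col mulmx0 !mul0mx addr0.
have [T [T' ST1 [ST' TT' dT wT]]] := movable_nonzero (isT : (1 < 1 + n.+1)%N) SM ST w0 e0.
suffices SMT : M *m T \in S.
  by rewrite -[M]mulmx1 -TT' mulmxA SM.
have detMT : \det (M *m T) = 1 by rewrite det_mulmx detM dT mulr1.
move: (M *m T) (mul_usub_mx M T) detMT => K.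
rewrite wT => uK detK.
pose y := dlsubmx K; pose K' := drsubmx K.
have def_K : K = block_mx (1%:M : 'M_1) 0 y K'.
  by rewrite -[LHS]submxK /ulsubmx /ursubmx -uK row_mxKl row_mxKr.
have fact_K : K = transvection (col_mx 0 y) e *m block_mx 1%:M 0 0 K'.
  rewrite def_K /transvection mul_col_row !mul0mx mulmx0 mulmx1.
  rewrite (scalar_mx_block 1 n.+1) add_block_mx !(addr0, add0r) mulmx_block.
  by rewrite !(mulmx0, mul0mx, mulmx1, mul1mx) !(addr0, add0r).
rewrite fact_K; apply: SM.
  by apply: ST; rewrite mul_row_col mulmx0 mul0mx addr0.
have := IHn K'; rewrite inE; apply; move: detK.
by rewrite def_K det_lblock det1 mul1r.
Qed.

Lemma transvections_generate_SL n (S : {set 'M[F]_n}) :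
  transvection_closed S -> forall M, \det M = 1 -> M \in S.
Proof.
elim: n S => [|[|n] IHn] S closS M detM.
- by case: closS; rewrite [M]thinmx0 [1%:M]thinmx0.
- by case: closS; rewrite [M]mx11_scalar -det_mx11 detM.
exact: (@transvection_closed_SL_step n S IHn closS).
Qed.

End Generation.

(** * Frames of maximal size *)

Section Dichotomy.

Local Open Scope ring_scope.

Variables (F : finFieldType) (n : nat) (S : {set 'M[F]_n}).
Hypotheses (grS : mxgroup S) (irrS : irreducible_mxset S).

Lemma frame_size_le b (A : 'M[F]_(b, n)) (B : 'M[F]_(n, b)) :
  A *m B = 1%:M -> (b <= n)%N.
Proof.
move=> AB; have /eqP <- : row_free A by apply/row_freeP; exists B.
exact: rank_leq_col.
Qed.

Lemma full_frame_SL b (A : 'M[F]_(b, n)) (B : 'M[F]_(n, b)) :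
  frame S A B -> b = n -> forall M, \det M = 1 -> M \in S.
Proof.
move=> [AB rAB] eq_bn; move: A B AB rAB; rewrite eq_bn => A B AB rAB.
have BA := mulmx1C AB; have [S1 SM _] := grS.
apply: transvections_generate_SL; split=> // f w wf.
have [|_ /(_ 1)] := has_rootP _ _ _ (rAB (w *m B) (A *m f) _).
  by rewrite -mulmxA (mulmxA B) BA mul1mx.
by rewrite mulmxA BA mul1mx -mulmxA BA mulmx1 scale1r.
Qed.

Lemma trsetK : trset (trset S) = S.
Proof. by apply/setP=> x; rewrite !inE trmxK. Qed.

Section MaximalFrame.

Variables (b : nat) (A : 'M[F]_(b, n)) (B : 'M[F]_(n, b)).
Hypotheses (frAB : frame S A B) (b_gt2 : (2 < b)%N).
Hypotheses (b_lt_n : (b < n)%N) (n_le2b : (n <= 2 * b)%N).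
Hypothesis no_pair :
  forall w f, attached S B w -> coattached S A f -> w *m f = 0.

Lemma coattached_eq0 f : coattached S A f -> f = 0.
Proof.
move=> Yf; apply: trmx_inj; rewrite trmx0.
apply: (attached_eq0 (mxgroup_tr grS) (frame_tr frAB) b_gt2
          (irreducible_mxset_tr irrS) b_lt_n n_le2b _ Yf).
move=> w g Yw; rewrite /coattached trsetK trmxK => Xg.
apply: trmx_inj; rewrite trmx_mul trmx0; apply: no_pair => //.
by rewrite /coattached trmxK.
Qed.

Lemma frame_rows_conj x :
  x \in S -> A *m invmx x *m B = 0 \/ A *m x = A *m x *m (B *m A).
Proof.
move=> Sx; have [|nz] := eqVneq (A *m invmx x *m B) 0; [by left | right].
apply/eqP; rewrite -subr_eq0; apply/eqP; apply: mulmx_rV_eq0 => u.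
apply: (attached_eq0 grS frAB b_gt2 irrS b_lt_n n_le2b no_pair).
rewrite mulmxBr mulmxA.
have := frame_rows_attached grS frAB b_gt2 (frameJ grS Sx frAB).
by rewrite [in X in X -> _]mulmxA => /(_ nz u); rewrite !mulmxA.
Qed.

Lemma frame_cols_conj x :
  x \in S -> A *m x *m B = 0 \/ invmx x *m B = B *m A *m (invmx x *m B).
Proof.
move=> Sx; have [|nz] := eqVneq (A *m x *m B) 0; [by left | right].
apply/eqP; rewrite -subr_eq0; apply/eqP; apply: mulmx_cV_eq0 => z.
apply: coattached_eq0.
have := frame_cols_coattached grS frAB b_gt2 (frameJ grS Sx frAB) nz z.
by rewrite mulmxBl !mulmxA.
Qed.

(** Write P = B A.  The rows of A x^-1 span the left kernel of B, which is the
    image of 1 - P, so x maps this image into that of P; and A x B = 0 says that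
    x maps the image of P into that of 1 - P. *)
Lemma frame_swapped x : x \in S -> n = (2 * b)%N ->
    A *m invmx x *m B = 0 -> A *m x *m B = 0 ->
  B *m A *m x = x *m (1%:M - B *m A).
Proof.
move=> Sx def_n AVxB AxB; have [AB _] := frAB; have [_ _ /(_ x Sx)[ux SVx]] := grS.
have [AVxxB _] := frameJ grS SVx frAB.
have QB : (1%:M - B *m A) *m B = 0.
  by rewrite mulmxBl mul1mx -mulmxA AB mulmx1 subrr.
have [C def_Q] := perp_row_span AVxxB AB AVxB n_le2b QB.
have Qx : (1%:M - B *m A) *m x *m (1%:M - B *m A) = 0.
  rewrite {1}def_Q -!mulmxA (mulmxA (invmx x)) mulVmx // mul1mx mulmxBr mulmx1.
  by rewrite mulmxA AB mul1mx subrr mulmx0.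
have PxP : B *m A *m x *m (B *m A) = 0.
  by rewrite mulmxA -!(mulmxA B) AxB mul0mx mulmx0.
move/eqP: Qx; rewrite !mulmxBl mul1mx !mulmxBr !mulmx1 PxP subr0 subr_eq0.
by move/eqP.
Qed.

(** Here K = A x B is the matrix of x on the span of A, and A x^-1 B is its
    inverse. *)
Lemma frame_stable x : x \in S ->
    A *m x = A *m x *m (B *m A) -> invmx x *m B = B *m A *m (invmx x *m B) ->
  B *m A *m x = x *m (B *m A).
Proof.
move=> Sx Ax VxB; have [AB _] := frAB; have [_ _ /(_ x Sx)[ux SVx]] := grS.
have KL : (A *m x *m B) *m (A *m invmx x *m B) = 1%:M.
  by rewrite -(mulmxA A (invmx x)) mulmxA -(mulmxA _ B) -Ax mulmxA mulmxK.
have LK := mulmx1C KL.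
have xB : x *m B = B *m (A *m x *m B).
  rewrite -[in LHS](mulmx1 B) -LK !mulmxA; congr (_ *m _ *m _ *m _).
  by rewrite -!mulmxA (mulmxA B) -VxB mulmxA mulmxV // mul1mx.
by rewrite (mulmxA x) xB -!mulmxA {1}Ax !mulmxA.
Qed.

(** Some x must violate the invariance of the span of A, and [frame_rows_conj]
    then gives A x^-1 B = 0, which is possible only if b <= n - b.  For each x
    the two alternatives, on rows and on columns, have to agree: in a mixed case
    one of A x, x^-1 B would vanish. *)
Lemma frame_imprimitive :
  n = (2 * b)%N /\ forall x, x \in S -> B *m A *m x = x *m (B *m A) \/
                      B *m A *m x = x *m (1%:M - B *m A).
Proof.
have [AB _] := frAB; have [nzA nzB] := frame_neq0 b_gt2 AB.
have [|stabA] := boolP [exists x in S, A *m invmx x *m B == 0]; last first.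
  have Ax x : x \in S -> A *m x = A *m x *m (B *m A).
    move=> Sx; case: (frame_rows_conj Sx) => // AVxB.
    by case/existsP: stabA; exists x; rewrite Sx AVxB /=.
  have [u uA] := mulmx_rV_neq0 nzA.
  have [z Qz] : exists z : 'cV_n, (1%:M - B *m A) *m z != 0.
    apply: mulmx_cV_neq0; rewrite subr_eq0; apply: contraTneq b_lt_n => BA.
    rewrite -leqNgt -(mxrank1 F n) BA.
    exact: leq_trans (mxrankM_maxl _ _) (rank_leq_col _).
  case: (irrS (w := u *m A) (f := (1%:M - B *m A) *m z)) => [x Sx|uA0|Qz0].
  - have PQ : B *m A *m (1%:M - B *m A) = 0.
      by rewrite mulmxBr mulmx1 mulmxA -(mulmxA B A) AB mulmx1 subrr.
    rewrite -(mulmxA u) Ax // -(mulmxA u) -(mulmxA _ _ (_ *m z)).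
    by rewrite (mulmxA (B *m A)) PQ mul0mx !mulmx0.
  - by rewrite uA0 eqxx in uA.
  by rewrite Qz0 eqxx in Qz.
case/exists_inP=> y Sy /eqP AVyB; have def_n : n = (2 * b)%N.
  apply/eqP; rewrite eqn_leq n_le2b /=.
  have rA : \rank (A *m invmx y) = b.
    apply/eqP/row_freeP; exists (y *m B).
    by rewrite mulmxA mulmxKV //; case: grS => _ _ /(_ y Sy)[].
  have rB : \rank B = b by apply/eqP/row_fullP; exists A.
  have /sub_kermxP/mxrankS : A *m invmx y *m B = 0 := AVyB.
  by rewrite mxrank_ker rA rB; lia.
split=> // x Sx; have [AxVxB _] := frameJ grS Sx frAB.
have [nzAx nzVxB] := frame_neq0 b_gt2 AxVxB.
have [Ax0 | Ax1] := frame_rows_conj Sx; have [Bx0 | Bx1] := frame_cols_conj Sx.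
- by right; apply: frame_swapped.
- by case/eqP: nzVxB; rewrite Bx1 -mulmxA (mulmxA A) Ax0 mulmx0.
- by case/eqP: nzAx; rewrite Ax1 mulmxA Bx0 mul0mx.
by left; apply: frame_stable.
Qed.

End MaximalFrame.

(** Downward induction on n - b: as long as an attached vector and a coattached
    form are not orthogonal, the frame can be enlarged, and the equality
    n = 2 b is excluded for the larger frame. *)
Lemma frame_dichotomy b (A : 'M[F]_(b, n)) (B : 'M[F]_(n, b)) :
    frame S A B -> (2 < b)%N -> (n <= 2 * b)%N ->
  (forall M, \det M = 1 -> M \in S) \/
  n = (2 * b)%N /\
  exists2 P : 'M_n, P *m P = P /\ \rank P = b
    & forall x, x \in S -> P *m x = x *m P \/ P *m x = x *m (1%:M - P).
Proof.
have [k] := ubnP (n - b); elim: k => // k IHk in b A B *.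
rewrite ltnS => le_k frAB b_gt2 n_le2b; have [AB _] := frAB.
have := frame_size_le AB; rewrite leq_eqVlt => /predU1P[eq_bn | b_lt_n].
  by left; exact: full_frame_SL frAB eq_bn.
have [/existsP[w /existsP[f /and3P[Xw Yf wf]]] | no_pair] :=
    boolP [exists w : 'rV_n, [exists f : 'cV_n,
             [&& attached S B w, coattached S A f & w *m f != 0]]].
  have [A1 [B1 fr1]] := frame_extend grS frAB b_gt2 Xw Yf wf.
  have [||||[def_n _]] := IHk _ _ _ _ fr1; try lia; first by left.
right; have [|def_n Sx] := frame_imprimitive frAB b_gt2 b_lt_n n_le2b.
  move=> w f Xw Yf; apply/eqP; apply: contraNT no_pair => wf.
  by apply/existsP; exists w; apply/existsP; exists f; rewrite Xw Yf.
split=> //; exists (B *m A) => //; split.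
  by rewrite mulmxA -(mulmxA B) AB mulmx1.
apply/eqP; rewrite eqn_leq (leq_trans (mxrankM_maxl _ _) (rank_leq_col _)) /=.
have rABAB : \rank (A *m (B *m A) *m B) = b by rewrite mulmxA AB mul1mx AB mxrank1.
rewrite -[leqLHS]rABAB.
exact: leq_trans (mxrankM_maxl _ _) (mxrankM_maxr _ _).
Qed.

End Dichotomy.

(** * The general linear group of the statement *)

Section Standard.

Local Open Scope ring_scope.

(** In a rank factorization P = L D U, with D the standard idempotent, the rows
    of D U span the image of P, and those of (1 - D) L^-1 its kernel, which is
    the image of 1 - P because P is idempotent.  The change of basis is the
    sum of these two matrices. *)
Lemma idempotent_split (F : fieldType) n (P : 'M[F]_n) : P *m P = P ->
  exists2 x : 'M_n, x \in unitmx
    & ((pid_mx (\rank P) : 'M_n) *m x :=: P)%MS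
      /\ (copid_mx (\rank P) *m x :=: 1%:M - P)%MS.
Proof.
move=> PP; have r_le : (\rank P <= n)%N := rank_leq_row P.
pose U := row_ebase P; pose L := invmx (col_ebase P).
pose x := pid_mx (\rank P) *m U + copid_mx (\rank P) *m L.
have pid_x : (pid_mx (\rank P) : 'M_n) *m x = pid_mx (\rank P) *m U.
  by rewrite mulmxDr !mulmxA mul_pid_mx_copid // mul0mx addr0 pid_mx_id.
have copid_x : copid_mx (\rank P) *m x = kermx P.
  by rewrite mulmxDr !mulmxA mul_copid_mx_pid // mul0mx add0r copid_mx_id.
have eqP1 : ((pid_mx (\rank P) : 'M_n) *m x :=: P)%MS.
  have defP : col_ebase P *m (pid_mx (\rank P) *m U) = P.
    by rewrite mulmxA mulmx_ebase.
  rewrite pid_x; apply/eqmxP/andP; split; apply/submxP; last by exists (col_ebase P).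
  by exists L; apply: canRL (mulKmx (col_ebase_unit P)) defP.
have eqQ : (copid_mx (\rank P) *m x :=: 1%:M - P)%MS.
  rewrite copid_x; apply/eqmxP/andP; split.
    apply/submxP; exists (kermx P).
    by rewrite mulmxBr mulmx1 mulmx_ker subr0.
  by apply/sub_kermxP; rewrite mulmxBl mul1mx PP subrr.
exists x => //; rewrite -row_full_unit -sub1mx.
rewrite -[1%:M](subrK P); apply: addmx_sub; first by rewrite -eqQ submxMl.
by rewrite -eqP1 submxMl.
Qed.

Variables (F : finFieldType) (N : nat).
Implicit Type G : {group {'GL_N[F]}}.

Definition mxset G : {set 'M[F]_N.-1.+1} := [set GLval g | g in G].

Lemma mxset_group G : mxgroup (mxset G).
Proof.
split=> [|_ _ /imsetP[x Gx ->] /imsetP[y Gy ->]|_ /imsetP[x Gx ->]].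
- by apply/imsetP; exists 1%g; rewrite ?group1.
- by apply/imsetP; exists (x * y)%g; rewrite ?groupM.
split; first exact: GL_unitmx.
by apply/imsetP; exists (x^-1)%g; rewrite ?groupV.
Qed.

(** Absolute irreducibility makes every matrix a combination of elements of G,
    so w M f = 0 for all M, in particular for all M of rank 1. *)
Lemma mxset_irreducible G :
  absolutely_irreducible G -> irreducible_mxset (mxset G).
Proof.
case/mx_abs_irrP=> _ [a_ def_M] w f wGf.
have wMf M : w *m M *m f = 0.
  rewrite (def_M M) mulmx_sumr mulmx_suml big1 // => x Gx.
  by rewrite -scalemxAr -scalemxAl wGf ?scaler0 //; apply/imsetP; exists x.
have [|w0] := eqVneq w 0; [by left | right].
apply: mulmx_rV_eq0 => u.
have [v wv] := mulmx_cV_neq0 w0.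
have := wMf (v *m u); rewrite mulmxA -(mulmxA _ u) [w *m v]mx11_scalar mul_scalar_mx.
move/eqP; rewrite scaler_eq0 => /predU1P[wv0|/eqP//].
by rewrite [w *m v]mx11_scalar wv0 -scalemx1 scale0r eqxx in wv.
Qed.

Lemma std_block_pid n a d (M : 'M[F]_a) : (a + d)%N = n ->
  conform_mx (1%:M : 'M_n) (block_mx M 0 0 (1%:M : 'M_d))
    = 1%:M + pid_mx a *m (M - 1%:M) *m pid_mx a.
Proof.
move=> <-; rewrite conform_mx_id pid_mx_col pid_mx_row mul_col_mx mul1mx mul0mx.
rewrite mul_col_row !mulmx0 !mul0mx mulmx1 (scalar_mx_block a d) add_block_mx.
by rewrite !addr0 addrC subrK.
Qed.

Lemma SLblock_frame G a : (a <= N)%N -> (0 < N)%N ->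
  SLblock F N a \subset G ->
  frame (mxset G) (pid_mx a : 'M_(a, N.-1.+1)) (pid_mx a : 'M_(N.-1.+1, a)).
Proof.
move=> a_le N_gt0 sSG; split=> [|u z uz].
  by rewrite mul_pid_mx minnn prednK // (minn_idPr a_le) pid_mx_1.
apply/has_rootP; split=> [|c].
  rewrite mulmxA -(mulmxA u) mul_pid_mx minnn prednK // (minn_idPr a_le).
  by rewrite pid_mx_1 mulmx1.
have dT : \det (transvection z (c *: u)) = 1.
  by apply: det_transvection; rewrite -scalemxAl uz scaler0.
have def_T : std_block N (transvection z (c *: u))
    = transvection (pid_mx a *m z) (c *: (u *m pid_mx a)).
  rewrite /std_block (std_block_pid _ (d := N - a)) ?subnKC ?prednK //.
  by rewrite /transvection (addrC 1%:M (z *m _)) addrK scalemxAl !mulmxA.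
pose T := transvection (pid_mx a *m z : 'cV[F]_N.-1.+1) (c *: (u *m pid_mx a)).
have uT : T \is a GRing.unit.
  rewrite -[_ \is a _]/(T \in unitmx) unitmxE det_transvection ?unitr1 //.
  rewrite -scalemxAl mulmxA -(mulmxA u) mul_pid_mx minnn prednK // (minn_idPr a_le).
  by rewrite pid_mx_1 mulmx1 uz scaler0.
pose g : {'GL_N[F]} := Sub T uT.
apply/imsetP; exists g => //; apply: (subsetP sSG).
rewrite inE; apply/existsP; exists (transvection z (c *: u)).
by rewrite dT eqxx def_T /=.
Qed.

Lemma mxset_SLn G :
  (forall M, \det M = 1 -> M \in mxset G) -> SLn F N \subset G.
Proof.
move=> sSLG; apply/subsetP=> g; rewrite inE => /eqP/sSLG/imsetP[h Gh].
by move/val_inj->.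
Qed.

Lemma eqmx_transport n (W1 W2 P1 P2 x g : 'M[F]_n) :
    x \in unitmx -> g \in unitmx -> (W1 *m x :=: P1)%MS -> (W2 *m x :=: P2)%MS ->
  P1 *m g = g *m P2 -> (W1 *m (x *m g *m invmx x) :=: W2)%MS.
Proof.
move=> ux ug W1x W2x P1g; rewrite !mulmxA -[X in (_ :=: X)%MS](mulmxK ux).
apply: eqmxMr; apply: eqmx_trans (eqmxMr g W1x) _.
rewrite P1g; apply: eqmx_trans (eqmx_sym W2x).
by apply: eqmxMfull; rewrite row_full_unit.
Qed.

Lemma pair_stab_conj G (P : 'M[F]_N.-1.+1) m :
    P *m P = P -> \rank P = m ->
    {in mxset G, forall x, P *m x = x *m P \/ P *m x = x *m (1%:M - P)} ->
  exists x : {'GL_N[F]}, (G :^ x)%g \subset pair_stab (pid_mx m) (copid_mx m).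
Proof.
move=> PP <- GP; have [x ux [xP xQ]] := idempotent_split PP.
pose X : {'GL_N[F]} := Sub x ux; exists (X^-1)%g; apply/subsetP=> h.
rewrite mem_conjgV => Gh; pose g := (h ^ X)%g.
have {Gh} /GP Pg : GLval g \in mxset G by apply/imsetP; exists g.
have ug : GLval g \in unitmx := GL_unitmx g.
have -> : h = (X * g * X^-1)%g by rewrite /g conjgE !mulgA mulgV mul1g mulgK.
rewrite inE !GL_MxE GL_VxE /=; apply/orP.
case: Pg => Pg; [left | right]; apply/andP; split; apply/eqmxP.
- exact: eqmx_transport Pg.
- by apply: (eqmx_transport ux ug xQ xQ); rewrite mulmxBl mulmxBr mul1mx mulmx1 Pg.
- exact: eqmx_transport Pg.
apply: (eqmx_transport ux ug xQ xP); rewrite mulmxBl mul1mx Pg mulmxBr mulmx1.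
by rewrite opprB addrC subrK.
Qed.

End Standard.

Theorem theorem1p3 (p k q : nat) (p_prime : prime p) (def_q : q = (p ^ k)%N)
    (F : finFieldType) (card_F : #|F| = q) (N : nat) (N_ge5 : 5 <= N)
    (q_gt3 : 3 < q) (Gamma : {group {'GL_N[F]}})
    (absG : absolutely_irreducible Gamma)
    (a : nat) (a_le_N : a <= N) (a_ge_halfN : N <= 2 * a)
    (SLaG : SLblock F N a \subset Gamma) :
  (N <> 2 * a -> SLn F N \subset Gamma) /\
  (N = 2 * a ->
     SLn F N \subset Gamma \/
     exists x : {'GL_N[F]}, (Gamma :^ x)%g \subset GLwrS2 F N).
Proof.
have N_gt0 : 0 < N by apply: leq_trans N_ge5.
have a_gt2 : 2 < a by lia.
have frG := SLblock_frame a_le_N N_gt0 SLaG.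
have le_n : N.-1.+1 <= 2 * a by rewrite prednK.
have [sSLG | [def_n [P [PP rP] GP]]] :=
  frame_dichotomy (mxset_group Gamma) (mxset_irreducible absG) frG a_gt2 le_n.
  by have sG := mxset_SLn sSLG; split; [|left].
rewrite prednK // in def_n; split=> // _; right.
have halfN : N./2 = a by rewrite def_n mul2n doubleK.
by rewrite /GLwrS2 halfN; apply: pair_stab_conj GP.
Qed.
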